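(* Let $1\le s,q,r,p<\infty$ with $q<s$ and $r\le s$. If $p\le q$, then the operator ideal $\mathcal{W}^{A}_{(s,q,r;p)}$ is injective. If $q\le p$, then the operator ideal $\Pi^{A}_{(p;s,q,r)}$ is injective.
   Context: Banach spaces are over $\mathbb{K}=\mathbb{R}$ or $\mathbb{C}$; $X^*$ is the topological dual of $X$, $\mathcal{L}(U;X)$ the space of continuous linear operators. $\ell_p(X)$ is the space of absolutely $p$-summable $X$-valued sequences, and $\ell_p^w(X)$ the space of weakly $p$-summable ones. The space $\ell^{A}_{(s,q,r)}(X)$ consists of all sequences $(x_j)_{j=1}^\infty$ in $X$ such that $\sum_{j=1}^\infty\left(\sum_{k=1}^\infty|x_k^*(x_j)|^s\right)^{q/s}<\infty$ for every $(x_k^* )_{k=1}^\infty\in\ell_r(X^* )$. For $1\le p\le q<s$, $1\le r\le s$: $\mathcal{W}^{A}_{(s,q,r;p)}(U;X)$ is the class of weakly anisotropic $(s,q,r;p)$-summing operators, i.e. those $T\in\mathcal{L}(U;X)$ such that $(T(u_j))_{j=1}^\infty\in\ell^{A}_{(s,q,r)}(X)$ whenever $(u_j)_{j=1}^\infty\in\ell_p^w(U)$. For $1\le q<s$, $q\le p$, $1\le r\le s$: $\Pi^{A}_{(p;s,q,r)}(U;X)$ is the class of anisotropic $(p;s,q,r)$-summing operators, i.e. those $T\in\mathcal{L}(U;X)$ such that $(T(u_j))_{j=1}^\infty\in\ell_p(X)$ whenever $(u_j)_{j=1}^\infty\in\ell^{A}_{(s,q,r)}(U)$. An operator ideal $\mathcal{I}$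 is injective if, for all Banach spaces $U,X,Y$ and $T\in\mathcal{L}(U;X)$, one has $T\in\mathcal{I}(U;X)$ whenever $v\in\mathcal{L}(X;Y)$ is a metric injection ($\|v(x)\|=\|x\|$ for every $x\in X$) such that $v\circ T\in\mathcal{I}(U;Y)$. *)

(* Defs.v *)
From HB Require Import structures.
From mathcomp Require Import all_boot all_order all_algebra.
From mathcomp Require Import complex.
From mathcomp Require Import all_classical all_reals all_analysis.
Import Order.TTheory GRing.Theory Num.Theory.
Import numFieldNormedType.Exports.

Set Implicit Arguments.
Unset Strict Implicit.
Unset Printing Implicit Defensive.

Local Open Scope classical_set_scope.
Local Open Scope ring_scope.

(* Norms of normed spaces over K take their values in K, while the exponents
   s, q, r, p and the sums live in R.  The map re reads a norm as an element
   of R; it is the identity over R and the real part over R[i], where norms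
   have zero imaginary part. *)
Variant scalar_field (R : realType) : forall K : numFieldType, (K -> R) -> Prop :=
| real_scalars : scalar_field (K := R) (fun x : R => x)
| complex_scalars : scalar_field (K := R[i]) (@complex.Re R).

Section anisotropic.
Variables (R : realType) (K : numFieldType) (re : K -> R).

Definition rnorm (V : normedModType K) (x : V) : R := re `|x|.

Definition power_summable (p : R) (a : nat -> \bar R) : Prop :=
  (\sum_(0 <= j <oo) (a j `^ p) < +oo)%E.

Definition dual_norm (X : normedModType K) (phi : {linear X -> K^o}) : \bar R :=
  ereal_sup [set (rnorm (phi x))%:E | x in [set x : X | rnorm x <= 1]].

Definition ell (p : R) (X : normedModType K) : set (nat -> X) :=
  [set x : nat -> X | power_summable p (fun j => (rnorm (x j))%:E)].

Definition ell_weak (p : R) (X : normedModType K) : set (nat -> X) :=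
  [set x : nat -> X | forall phi : {linear X -> K^o}, continuous phi ->
     power_summable p (fun j => (rnorm (phi (x j)))%:E)].

Definition ell_dual (r : R) (X : normedModType K) : set (nat -> {linear X -> K^o}) :=
  [set f : nat -> {linear X -> K^o} | (forall k, continuous (f k)) /\
     power_summable r (fun k => dual_norm (f k))].

Definition ell_aniso (s q r : R) (X : normedModType K) : set (nat -> X) :=
  [set x : nat -> X | forall f : nat -> {linear X -> K^o}, ell_dual r f ->
     (\sum_(0 <= j <oo)
        ((\sum_(0 <= k <oo) ((rnorm (f k (x j)))%:E `^ s)) `^ (q / s)) < +oo)%E].

Definition operator_class : Type :=
  forall U X : completeNormedModType K, set {linear U -> X}.

Definition weakly_aniso_summing (s q r p : R) : operator_class :=
  fun U X => [set T : {linear U -> X} | continuous T /\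
    forall u : nat -> U, ell_weak p u -> ell_aniso s q r (fun j => T (u j))].

Definition aniso_summing (p s q r : R) : operator_class :=
  fun U X => [set T : {linear U -> X} | continuous T /\
    forall u : nat -> U, ell_aniso s q r u -> ell p (fun j => T (u j))].

Definition metric_injection (X Y : completeNormedModType K) (v : {linear X -> Y}) :
    Prop :=
  continuous v /\ forall x : X, `|v x| = `|x|.

Definition injective_class (I : operator_class) : Prop :=
  forall (U X Y : completeNormedModType K) (T : {linear U -> X}),
    continuous T ->
    forall v : {linear X -> Y}, metric_injection v ->
      I U Y (v \o T : {linear U -> Y}) -> I U X T.

End anisotropic.

(* Main.v *)
(* Since [v] is isometric, summability of [v (T u_j)] in [Y] is that of
   [T u_j] in [X], which settles the second ideal.  For the first one, the
   sequences of functionals testing [T u_j] live on [X]; by the Hahn-Banach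
   theorem each extends along [v] to a functional on [Y] without increasing
   its norm, and the extensions form an admissible test for [v (T u_j)]. *)
From HB Require Import structures.
Require Import Defs.
From mathcomp Require Import all_boot all_order all_algebra.
From mathcomp Require Import complex ring lra.
From mathcomp Require Import all_classical all_reals all_analysis.
Import Order.TTheory GRing.Theory Num.Theory.
Import numFieldNormedType.Exports.
Local Open Scope classical_set_scope.
Local Open Scope ring_scope.

(* Linearity over [R] is expressed through [i : R -> K], so that the real
   theorem applies to complex spaces without restricting scalars. *)
Section HahnBanach.
Variables (R : realType) (K : numFieldType) (i : {rmorphism R -> K}).
Variables (V : lmodType K) (p : V -> R).
Hypothesis pD : forall x y, p (x + y) <= p x + p y.
Hypothesis pZ : forall a x, 0 <= a -> p (i a *: x) = a * p x.

(** A partial functional below [p] is encoded by its graph, so that extension is inclusion and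
    Zorn's lemma for sets applies. Single-valuedness follows from domination. *)
Definition dominated_subspace (G : set (V * R)) : Prop :=
  (forall a u w, G u -> G w -> G (i a *: u.1 + w.1, a * u.2 + w.2)) /\
  (forall u, G u -> u.2 <= p u.1).

(** The difference of two pairs over one point lies over [0], where [p] vanishes; hence each value
    is at most the other. *)
Lemma dominated_subspace_inj {G : set (V * R)} {u w} :
  dominated_subspace G -> G u -> G w -> u.1 = w.1 -> u.2 = w.2.
Proof.
move=> [Glin Gp].
have p0 : p 0 = 0 by rewrite -(scaler0 _ (i 0)) pZ ?mul0r.
have le u' w' : G u' -> G w' -> u'.1 = w'.1 -> w'.2 <= u'.2.
  move=> Gu Gw e; have := Gp _ (Glin (-1) _ _ Gu Gw).
  by rewrite /= e rmorphN1 scaleN1r addNr p0 mulN1r addrC subr_le0.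
by move=> Gu Gw e; apply/le_anti; rewrite !le.
Qed.

Lemma dominated_subspaceZ {G : set (V * R)} {a u} :
  dominated_subspace G -> G u -> G (i a *: u.1, a * u.2).
Proof.
move=> [Glin Gp] Gu.
have := Glin a _ _ Gu (Glin (-1) _ _ Gu Gu).
by rewrite /= rmorphN1 scaleN1r mulN1r !addNr !addr0.
Qed.

(* The new value [c] must lie between all [w.2 - p (w.1 - x)] and all
   [p (w.1 + x) - w.2]; the supremum of the former does. *)
Lemma dominated_subspace_extend (G : set (V * R)) (x : V) :
  dominated_subspace G -> G !=set0 ->
  exists c, dominated_subspace
    [set u | exists a w, G w /\ u = (i a *: x + w.1, a * c + w.2)].
Proof.
move=> domG [w0 Gw0]; have [Glin Gp] := domG.
pose A := [set w.2 - p (w.1 - x) | w in G].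
(* Subadditivity: [u.2 + w.2 <= p (u.1 + w.1) <= p (u.1 - x) + p (w.1 + x)]. *)
have Aub w : G w -> ubound A (p (w.1 + x) - w.2).
  move=> Gw _ [u Gu <-]; rewrite lerBlDr addrAC lerBrDr.
  have := Gp _ (Glin 1 _ _ Gu Gw); rewrite /= rmorph1 scale1r mul1r.
  move=> /le_trans; apply.
  by rewrite [leRHS]addrC (le_trans _ (pD _ _))// addrACA addNr addr0.
have A0 : A !=set0 by exists (w0.2 - p (w0.1 - x)), w0.
have supA : has_sup A by split=> //; exists (p (w0.1 + x) - w0.2); exact: Aub.
exists (sup A); split.
  move=> a u u' [b [w [Gw ->]]] [b' [w' [Gw' ->]]] /=.
  exists (a * b + b'), (i a *: w.1 + w'.1, a * w.2 + w'.2).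
  split; first exact: Glin.
  congr pair => /=; last by ring.
  by rewrite rmorphD rmorphM scalerDl scalerDr scalerA addrACA.
move=> _ [a [w [Gw ->]]] /=.
(* Dividing [w] by the absolute value of [a] reduces to the coefficients 1 and -1, where the upper
   and the lower bounds on [c] apply respectively. *)
have [a0|a0|->] := ltgtP a 0; last first.
- by rewrite rmorph0 scale0r add0r mul0r add0r Gp.
- have aN0 : a != 0 by rewrite gt_eqF.
  have Gw' := @dominated_subspaceZ _ a^-1 _ domG Gw.
  have := ge_sup A0 (Aub _ Gw'); rewrite /= -(ler_pM2l a0).
  rewrite mulrBr mulrA divff// mul1r -pZ ?(ltW a0)// scalerDr scalerA.
  rewrite -rmorphM divff// rmorph1 scale1r [w.1 + _]addrC; lra.
- have b0 : 0 < - a by rewrite oppr_gt0.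
  have bN0 : - a != 0 by rewrite gt_eqF.
  have Gw' := @dominated_subspaceZ _ (- a)^-1 _ domG Gw.
  have /(ub_le_sup (proj2 supA)) : A ((- a)^-1 * w.2 - p (i (- a)^-1 *: w.1 - x)).
    by exists (i (- a)^-1 *: w.1, (- a)^-1 * w.2).
  rewrite -(ler_pM2l b0) mulrBr mulrA divff// mul1r -pZ ?(ltW b0)// scalerBr.
  rewrite scalerA -rmorphM divff// rmorph1 scale1r rmorphN scaleNr opprK.
  rewrite [w.1 + _]addrC; lra.
Qed.

Lemma hahn_banach (X : lmodType K) (v : {linear X -> V}) (f : X -> R) :
  (forall a x y, f (i a *: x + y) = a * f x + f y) ->
  (forall x, f x <= p (v x)) ->
  exists g : V -> R, [/\ forall a x y, g (i a *: x + y) = a * g x + g y,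
    forall x, g x <= p x & forall x, g (v x) = f x].
Proof.
(* [G0] is the graph of the functional that [f] induces on the range of [v]. *)
move=> flin fp; pose G0 := [set (v x, f x) | x in [set: X]].
(* Adjoining [G0] to every candidate lets the empty chain satisfy the property too. *)
have [A [domA maxA]] : exists A, dominated_subspace (A `|` G0) /\
    forall B, A `<` B -> ~ dominated_subspace (B `|` G0).
  apply: (@Zorn_bigcup _ (fun A => dominated_subspace (A `|` G0))).
  move=> F Fdom Ftot; have G0dom : dominated_subspace G0.
    split=> [a _ _ [x _ <-] [y _ <-]|_ [x _ <-]] /=; last exact: fp.
    by exists (i a *: x + y) => //; rewrite linearP flin.
  have incl A : F A -> A `|` G0 `<=` \bigcup_(X in F) X `|` G0.
    by move=> FA u [Au|]; [left; exists A|right].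
  split=> [a u w|u [[A FA Au]|]]; last exact: G0dom.2.
    move=> [[A FA Au]|Gu] [[B FB Bw]|Gw]; last by right; exact: G0dom.1.
    - have [AB|BA] := Ftot _ _ FA FB.
        by apply: (incl B) => //; apply: (Fdom _ FB).1; left => //; exact: AB.
      by apply: (incl A) => //; apply: (Fdom _ FA).1; left => //; exact: BA.
    - by apply: (incl A) => //; apply: (Fdom _ FA).1; [left|right].
    - by apply: (incl B) => //; apply: (Fdom _ FB).1; [right|left].
  by apply: (Fdom _ FA).2; left.
set G := A `|` G0 in domA.
have G00 : G !=set0 by exists (v 0, f 0); right; exists 0.
(* Otherwise the one-step extension [B] in the direction [x] would contradict the maximality of
   [A]. *)
have total x : exists c, G (x, c).
  have [c domB] := dominated_subspace_extend _ x domA G00.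
  set B := [set u | _] in domB.
  have GB : G `<=` B.
    move=> w Gw; exists 0, w; split=> //.
    by rewrite rmorph0 scale0r mul0r !add0r; case: w Gw.
  have Bxc : B (x, c).
    have [w Gw] := G00; exists 1, (i 0 *: w.1, 0 * w.2).
    split; first exact: dominated_subspaceZ.
    by rewrite /= rmorph0 rmorph1 scale0r scale1r mul0r mul1r !addr0.
  exists c; apply: contrapT => GNxc; apply: (maxA B).
    split=> [u Au|BA]; first by apply: GB; left.
    by apply: GNxc; left; exact: BA.
  suff -> : B `|` G0 = B by [].
  by apply/setUidPl => u G0u; apply: GB; right.
have [g Gg] := choice total; exists g; split=> [a x y|x|x].
- by apply: (dominated_subspace_inj domA (Gg _)
    (domA.1 a _ _ (Gg x) (Gg y))).
- exact: domA.2 (Gg x).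
- have Gv : G (v x, f x) by right; exists x.
  exact: (dominated_subspace_inj domA (Gg _) Gv).
Qed.

End HahnBanach.

Lemma hahn_banach_real (R : realType) (X Y : normedModType R)
    (v : {linear X -> Y}) (f : {linear X -> R^o}) (C : R) :
  0 <= C -> (forall x, `|f x| <= C * `|v x|) ->
  exists g : {linear Y -> R^o},
    (forall y, `|g y| <= C * `|y|) /\ forall x, g (v x) = f x.
Proof.
move=> C0 fC.
have [| | | |g [glin gC gv]] := @hahn_banach R R idfun Y
    (fun y => C * `|y|) _ _ X v f.
- by move=> x y; rewrite -mulrDr ler_wpM2l ?ler_normD.
- by move=> a x a0; rewrite normrZ ger0_norm// mulrCA.
- by move=> a x y; rewrite linearP.
- by move=> x; rewrite (le_trans (ler_norm _)).
pose g' : {linear Y -> R^o} :=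
  HB.pack (g : Y -> R^o) (GRing.isLinear.Build _ _ _ _ (g : Y -> R^o) glin).
(* The lower bound on [g y] is the upper bound at [- y]. *)
exists g'; split=> // y; rewrite ler_norml gC andbT lerNl.
have /= := glin (-1) y 0; have /= := glin 1 0 0.
rewrite !scaler0 !addr0 mulN1r scaleN1r => g0 gN.
by have := gC (- y); rewrite normrN; lra.
Qed.

(* A complex functional is recovered from its real part [g] as
   [y |-> g y - 'i * g ('i *: y)]. *)
Lemma hahn_banach_complex (R : realType) (X Y : normedModType R[i])
    (v : {linear X -> Y}) (f : {linear X -> R[i]^o}) (C : R[i]) :
  0 <= C -> (forall x, `|f x| <= C * `|v x|) ->
  exists g : {linear Y -> R[i]^o},
    (forall y, `|g y| <= C * `|y|) /\ forall x, g (v x) = f x.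
Proof.
move=> C0 fC.
have normR (V : normedModType R[i]) (y : V) : `|y| = (complex.Re `|y|)%:C%C.
  by rewrite RRe_real ?normr_real.
have CR : C = (complex.Re C)%:C%C by rewrite RRe_real ?ger0_real.
have ReC0 : 0 <= complex.Re C by rewrite -ler0c -CR.
(* The real part of [f] is extended as a real-linear functional. *)
have [| | | |g [glin gC gv]] := @hahn_banach R R[i] (real_complex R) Y
    (fun y => complex.Re C * complex.Re `|y|) _ _ X v (fun x => complex.Re (f x)).
- move=> x y; rewrite -mulrDr ler_wpM2l// -raddfD.
  by have := ler_normD x y; rewrite lecE => /andP[].
- move=> a x a0; rewrite normrZ ger0_norm ?ler0c//.
  by rewrite normR -rmorphM /= mulrCA.
- move=> a x y; rewrite linearP raddfD; congr (_ + _).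
  by rewrite /GRing.scale /=; case: (f x) => b c /=; rewrite mul0r subr0.
- move=> x; have := fC x; rewrite CR [in leRHS]normR -rmorphM.
  rewrite (normR _ (f x)) lecR; apply: le_trans.
  by have := normc_ge_Re (f x); rewrite lecE => /andP[_]; apply/le_trans/ler_norm.
have gD x y : g (x + y) = g x + g y.
  by have := glin 1 x y; rewrite rmorph1 scale1r mul1r.
have g0 : g 0 = 0 by have := gD 0 0; rewrite addr0; lra.
have gZ a x : g (a%:C%C *: x) = a * g x by rewrite -[_ *: x]addr0 glin g0 addr0.
have gN x : g (- x) = - g x by have := gD x (- x); rewrite subrr g0; lra.
have gZc c x : g (c *: x) = complex.Re c * g x + complex.Im c * g ('i%C *: x).
  by rewrite {1}[c]complexE ['i%C * _]mulrC scalerDl gD -scalerA !gZ.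
have giZc c x :
    g ('i%C *: (c *: x)) = complex.Re c * g ('i%C *: x) - complex.Im c * g x.
  by rewrite scalerA mulrC -scalerA gZc scalerA -expr2 sqr_i scaleN1r gN mulrN.
pose h (y : Y) : R[i]^o := (g y +i* - g ('i%C *: y))%C.
have hlin : linear h.
  move=> c x y; rewrite /h scalerDr !gD gZc giZc.
  case: c => a b; rewrite /GRing.scale /=.
  by apply/eqP; rewrite eq_complex /=; apply/andP; split; apply/eqP; ring.
pose h' : {linear Y -> R[i]^o} :=
  HB.pack h (GRing.isLinear.Build _ _ _ _ h hlin).
exists h'; split=> [y|x].
  have [h0|hN0] := eqVneq (h' y) 0; first by rewrite h0 normr0 mulr_ge0.
  (* Rotating [y] by [t] makes [h' y] real, where it equals [g]. *)
  pose t := `|h' y| / h' y.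
  have t1 : `|t| = 1 by rewrite normf_div normr_id divff ?normr_eq0.
  have hty : `|h' y| = h' (t *: y) by rewrite linearZ /= [RHS]mulrVK ?unitfE.
  have -> : `|y| = `|t *: y| by rewrite normrZ t1 mul1r.
  by rewrite [leLHS]normR hty CR (normR _ (t *: y)) -rmorphM lecR gC.
(* On the range of [v], the identity Re f(ix) = -Im f(x) restores the imaginary part. *)
rewrite /= /h -linearZ !gv linearZ /=.
case: (f x) => a b; rewrite /GRing.scale /=; apply/eqP.
by rewrite eq_complex /= eqxx /=; apply/eqP; ring.
Qed.

(** This lets inequalities between norms move between [K] and [R] uniformly for both scalar
    fields. *)
Lemma scalar_field_embedding {R : realType} {K : numFieldType} {re : K -> R} :
  scalar_field re -> exists i : {rmorphism R -> K},
    [/\ cancel i re, {in Num.real, cancel re i} & {mono i : a b / a <= b}].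
Proof.
case=> [|]; first by exists idfun.
exists (real_complex R); split=> [//|x /RRe_real//|a b]; exact: lecR.
Qed.

Section MetricInjection.
Variables (R : realType) (K : numFieldType) (re : K -> R).
Hypothesis hK : scalar_field re.

Lemma hahn_banach_scalar {X Y : normedModType K}
    {v : {linear X -> Y}} {f : {linear X -> K^o}} {C : K} :
  0 <= C -> (forall x, `|f x| <= C * `|v x|) ->
  exists g : {linear Y -> K^o},
    (forall y, `|g y| <= C * `|y|) /\ forall x, g (v x) = f x.
Proof.
case: hK X Y v f C => X Y v f C; [exact: hahn_banach_real|].
exact: hahn_banach_complex.
Qed.

Lemma dual_norm_ge0 (X : normedModType K) (f : {linear X -> K^o}) :
  (0 <= dual_norm re f)%E.
Proof.
have [i [iK reK i_le]] := scalar_field_embedding hK.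
apply: ereal_sup_ubound; exists 0.
  by rewrite /= -i_le reK ?normr_real// normr0 rmorph1.
by rewrite linear0 /rnorm normr0 -(rmorph0 i) iK.
Qed.

Lemma bounded_linear_extension {X Y : normedModType K} {v : {linear X -> Y}}
    {f : {linear X -> K^o}} :
  (forall x, `|v x| = `|x|) -> continuous f ->
  exists g : {linear Y -> K^o}, [/\ continuous g,
    (dual_norm re g <= dual_norm re f)%E & forall x, g (v x) = f x].
Proof.
move=> vE cf; have [i [iK reK i_le]] := scalar_field_embedding hK.
have rE (V : normedModType K) (x : V) : `|x| = i (rnorm re x).
  by rewrite reK ?normr_real.
have /linear_boundedP/pinfty_ex_gt0[M M0 fM] : bounded_near f (nbhs 0).
  exact/linear_bounded_continuous.
have ME : M = i (re M) by rewrite reK ?gtr0_real.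
(* Continuity bounds [f] by some [M] on the unit ball, so the dual norm is finite and [fine] loses
   nothing. *)
pose c := fine (dual_norm re f).
have fin : dual_norm re f = c%:E.
  rewrite fineK// ge0_fin_numE ?dual_norm_ge0//.
  apply: (@le_lt_trans _ _ (re M)%:E); last exact: ltry.
  apply: ge_ereal_sup => _ [x /= x1 <-]; rewrite lee_fin -i_le -rE -ME.
  by rewrite (le_trans (fM x))// ler_piMr ?(ltW M0)// rE -(rmorph1 i) i_le.
have c0 : 0 <= c by rewrite -lee_fin -fin dual_norm_ge0.
have ic0 : 0 <= i c by rewrite -(rmorph0 i) i_le.
(* As [v] is isometric, this is the usual dual norm estimate, obtained by normalizing [x]. *)
have fc x : `|f x| <= i c * `|v x|.
  rewrite vE; have [->|x0] := eqVneq x 0; first by rewrite linear0 !normr0 mulr0.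
  have nx0 : 0 < `|x| by rewrite normr_gt0.
  have : ((rnorm re (f (`|x|^-1 *: x)))%:E <= c%:E)%E.
    rewrite -fin; apply: ereal_sup_ubound; exists (`|x|^-1 *: x) => //=.
    rewrite -i_le -rE normrZ ger0_norm ?invr_ge0// mulVf ?gt_eqF//.
    by rewrite rmorph1.
  rewrite lee_fin -i_le -rE linearZ normrZ ger0_norm ?invr_ge0//.
  by rewrite mulrC ler_pdivrMr.
have [g [gc gv]] := hahn_banach_scalar ic0 fc; exists g; split=> //.
  apply: bounded_linear_continuous; apply/linear_boundedP.
  near=> r => x; rewrite (le_trans (gc x))// ler_wpM2r//.
  by near: r; apply: nbhs_pinfty_ge; exact: ger0_real.
apply: ge_ereal_sup => _ [y /= y1 <-]; rewrite fin lee_fin -i_le -rE.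
by rewrite (le_trans (gc y))// ler_piMr// rE -(rmorph1 i) i_le.
Unshelve. all: by end_near. Qed.

(** Each functional is extended separately; since no dual norm grows, the sum of [r]-th powers stays
    finite by comparison. *)
Lemma ell_dual_extension {r : R} {X Y : normedModType K} {v : {linear X -> Y}}
    {f : nat -> {linear X -> K^o}} :
  0 <= r -> (forall x, `|v x| = `|x|) -> ell_dual re r f ->
  exists2 g : nat -> {linear Y -> K^o},
    ell_dual re r g & forall k x, g k (v x) = f k x.
Proof.
move=> r0 vE [cf sf].
have /choice[g gP] k := bounded_linear_extension vE (cf k).
exists g => [|k]; last by have [] := gP k.
split=> [k|]; first by have [] := gP k.
apply: le_lt_trans sf; apply: lee_nneseries => k _.
  by move=> _; exact: poweR_ge0.
have [_ gf _] := gP k.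
by apply: gt0_ler_poweR => //; rewrite in_itv/= leey andbT dual_norm_ge0.
Qed.

End MetricInjection.

Theorem proposition3p18 (R : realType) (K : numFieldType) (re : K -> R)
    (hK : scalar_field re) (s q r p : R)
    (hs : 1 <= s) (hq : 1 <= q) (hr : 1 <= r) (hp : 1 <= p)
    (hqs : q < s) (hrs : r <= s) :
  (p <= q -> injective_class (weakly_aniso_summing re s q r p)) /\
  (q <= p -> injective_class (aniso_summing re p s q r)).
Proof.
split=> _ U X Y T cT v [_ vE] [_ vT]; split=> // u hu.
- move=> f hf; have r0 : 0 <= r by rewrite (le_trans _ hr).
  have [g hg gv] := ell_dual_extension _ _ _ hK r0 vE hf.
  (* The double sum of [g] at [v (T (u j))] is term by term that of [f] at [T (u j)]. *)
  have := vT u hu g hg; apply: le_lt_trans.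
  by under eq_eseriesr do under eq_eseriesr do rewrite -gv.
- have := vT u hu; rewrite /ell /power_summable /= /rnorm.
  by under eq_eseriesr do rewrite vE.
Qed.
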